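(* Let $H_0,H_1,H_2$ be Hilbert spaces and let $A_0:D(A_0)\subset H_0\to H_1$ and $A_1:D(A_1)\subset H_1\to H_2$ be densely defined and closed (unbounded) linear operators with $R(A_0)\subset N(A_1)$. Let $D(A_1)=H_1^++A_0H_0^+$ be a regular decomposition. Then the embedding $D(A_1)\cap D(A_0^* )\hookrightarrow H_1$ is compact.
   Context: $D(\cdot),N(\cdot),R(\cdot)$ denote domain, kernel, range; $A^*$ is the Hilbert space adjoint. Domains $D(A)$ are equipped with the graph norm and $D(A_1)\cap D(A_0^* )$ with the norm $|x|_{H_1}+|A_1x|_{H_2}+|A_0^*x|_{H_0}$. Regular decomposition: for Hilbert spaces $H_0^+\subset D(A_0)$ and $H_1^+\subset D(A_1)$, a decomposition $D(A_1)=H_1^++A_0H_0^+$ such that the embeddings $H_0^+\hookrightarrow H_0$ and $H_1^+\hookrightarrow H_1$ are compact is called a regular decomposition if there are bounded linear operators $Q_{A_1}:D(A_1)\to H_1^+$ and $\widetilde Q_{A_0}:D(A_1)\to H_0^+$ with $x=Q_{A_1}x+A_0\widetilde Q_{A_0}x$ for all $x\in D(A_1)$. *)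

(* Defs.v *)
From HB Require Import structures.
From mathcomp Require Import all_boot all_order all_algebra complex.
From mathcomp Require Import all_classical all_reals all_analysis.

Set Implicit Arguments.
Unset Strict Implicit.
Unset Printing Implicit Defensive.

Import Order.TTheory GRing.Theory Num.Theory.
Import numFieldNormedType.Exports.

Local Open Scope classical_set_scope.
Local Open Scope ring_scope.

(* Hilbert spaces may be real or complex; all the spaces of a given statement
   share the same scalar field. *)
Variant scalar_kind := RealScalars | ComplexScalars.

Definition scalar_field (R : realType) (k : scalar_kind) : numFieldType :=
  match k with RealScalars => R | ComplexScalars => R[i]%C end.

Definition scalar_conj (R : realType) (k : scalar_kind) :
    {rmorphism scalar_field R k -> scalar_field R k} :=
  match k return {rmorphism scalar_field R k -> scalar_field R k} with
  | RealScalars => @idfun R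
  | ComplexScalars => @Num.conj R[i]%C
  end.

(* [hdot] is linear in its first argument and [theta]-semilinear in its second
   one; norms take their values in [K], so that in the complex case they are
   nonnegative elements of [R[i]]. *)
Record hilbertType (K : numFieldType) (theta : {rmorphism K -> K}) := Hilbert {
  hilbert_sort :> completeNormedModType K ;
  hdot : {dot hilbert_sort for theta} ;
  hdot_norm : forall x : hilbert_sort, `|x| ^+ 2 = hdot x x
}.

Record unbounded_op (K : numFieldType) (U V : normedModType K) := UnboundedOp {
  dom : set U ;
  (* the values outside of [dom] are irrelevant *)
  app :> U -> V ;
  dom0 : dom 0 ;
  domP : forall (a : K) (x y : U), dom x -> dom y -> dom (a *: x + y) ;
  appP : forall (a : K) (x y : U), dom x -> dom y ->
    app (a *: x + y) = a *: app x + app y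
}.

Definition densely_defined (K : numFieldType) (U V : normedModType K)
  (A : unbounded_op U V) : Prop := dense (dom A).

Definition graph_of (K : numFieldType) (U V : normedModType K)
  (A : unbounded_op U V) : set (U * V) := [set p | dom A p.1 /\ p.2 = A p.1].

Definition closed_op (K : numFieldType) (U V : normedModType K)
  (A : unbounded_op U V) : Prop := closed (graph_of A).

Definition kernel_of (K : numFieldType) (U V : normedModType K)
  (A : unbounded_op U V) : set U := [set x | dom A x /\ A x = 0].

Definition range_of (K : numFieldType) (U V : normedModType K)
  (A : unbounded_op U V) : set V := A @` dom A.

Definition graph_norm (K : numFieldType) (U V : normedModType K)
  (A : unbounded_op U V) (x : U) : K := `|x| + `|A x|.

Section Adjoint.
Variables (K : numFieldType) (theta : {rmorphism K -> K}).
Variables (H G : hilbertType theta) (A : unbounded_op H G).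
Hypothesis dA : densely_defined A.

Definition adjoint_rel (y : G) (z : H) : Prop :=
  forall x, dom A x -> hdot G (A x) y = hdot H x z.

Definition adjoint_dom : set G := [set y | exists z, adjoint_rel y z].

Definition adjoint_fun (y : G) : H := xget 0 [set z | adjoint_rel y z].

Lemma adjoint_rel_uniq y z z' : adjoint_rel y z -> adjoint_rel y z' -> z = z'.
Proof.
move=> yz yz'; apply/eqP; rewrite -subr_eq0; apply/negPn/negP => w0.
set w := z - z' in w0.
have [x [wx Dx]] : ball w `|w| `&` dom A !=set0.
  apply: dA; last exact: ball_open.
  by exists w; apply: ballxx; rewrite normr_gt0.
have xw : hdot H x w = 0.
  have -> : hdot H x w = hdot H x z - hdot H x z' by exact: linearBr.
  by rewrite -(yz _ Dx) -(yz' _ Dx) subrr.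
have wx0 : hdot H w x = 0.
  have -> : hdot H w x = (-1) ^+ false * theta (hdot H x w) by exact: hermC.
  by rewrite xw rmorph0 mulr0.
move: wx; rewrite -ball_normE /ball_ /=.
rewrite -(ltr_pXn2r (n := 2)) ?nnegrE // !hdot_norm.
have -> : hdot H (w - x) (w - x) = hdot H w w + hdot H x x by exact: hnormBd.
by rewrite gtrDl -hdot_norm le_gtF // exprn_ge0.
Qed.

Lemma adjoint_funP y : adjoint_dom y -> adjoint_rel y (adjoint_fun y).
Proof. by move=> [z yz]; apply: (xgetPex 0); exists z. Qed.

Lemma adjoint_dom0 : adjoint_dom 0.
Proof. by exists 0 => x _; rewrite !linear0r. Qed.

Lemma adjoint_relP a y y' z z' : adjoint_rel y z -> adjoint_rel y' z' ->
  adjoint_rel (a *: y + y') (a *: z + z').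
Proof.
move=> yz yz' x Dx.
transitivity (theta a * hdot G (A x) y + hdot G (A x) y').
  exact: (@linearPr _ _ _ _ _ _ (hdot G) (A x) a y y').
by rewrite (yz _ Dx) (yz' _ Dx); apply/esym/(@linearPr _ _ _ _ _ _ (hdot H) x a z z').
Qed.

Lemma adjoint_domP a y y' : adjoint_dom y -> adjoint_dom y' ->
  adjoint_dom (a *: y + y').
Proof.
by move=> [z yz] [z' yz']; exists (a *: z + z'); apply: adjoint_relP.
Qed.

Lemma adjoint_linear a y y' : adjoint_dom y -> adjoint_dom y' ->
  adjoint_fun (a *: y + y') = a *: adjoint_fun y + adjoint_fun y'.
Proof.
move=> Dy Dy'; apply: (@adjoint_rel_uniq (a *: y + y')).
  exact/adjoint_funP/adjoint_domP.
by apply: adjoint_relP; apply: adjoint_funP.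
Qed.

Definition adjoint : unbounded_op G H :=
  UnboundedOp adjoint_dom0 adjoint_domP adjoint_linear.

End Adjoint.

(* A map [f], linear on the subspace [D] normed by [N], is bounded (resp.
   compact) for the norm [N]. Since [D] and [N] are explicit, this applies to
   domains equipped with their graph norm. *)
Definition bounded_linear_on (K : numFieldType) (U V : normedModType K)
    (D : set U) (N : U -> K) (f : U -> V) : Prop :=
  (forall (a : K) (x y : U), D x -> D y -> f (a *: x + y) = a *: f x + f y) /\
  (exists C : K, forall x, D x -> `|f x| <= C * N x).

Definition compact_on (K : numFieldType) (U V : normedModType K)
    (D : set U) (N : U -> K) (f : U -> V) : Prop :=
  forall M : K, precompact (f @` [set x | D x /\ N x <= M]).

(* The inclusions of [H0p] in [D(A0)] and of [H1p] in [D(A1)] are given by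
   injective linear maps [i0] and [i1]: [H0p] and [H1p] carry their own
   Hilbert space structures. *)
Record regular_decomposition (K : numFieldType) (theta : {rmorphism K -> K})
    (H0 H1 H2 : hilbertType theta)
    (A0 : unbounded_op H0 H1) (A1 : unbounded_op H1 H2)
    (H0p H1p : hilbertType theta)
    (i0 : {linear H0p -> H0}) (i1 : {linear H1p -> H1}) : Prop := {
  regdec_inj0 : injective i0 ;
  regdec_inj1 : injective i1 ;
  regdec_sub0 : range i0 `<=` dom A0 ;
  regdec_sub1 : range i1 `<=` dom A1 ;
  regdec_sum : dom A1 = [set i1 u + A0 (i0 v) | u in setT & v in setT] ;
  regdec_compact0 : compact_on setT (fun v : H0p => `|v|) i0 ;
  regdec_compact1 : compact_on setT (fun u : H1p => `|u|) i1 ;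
  regdec_potentials : exists (Q1 : H1 -> H1p) (Q0 : H1 -> H0p),
    [/\ bounded_linear_on (dom A1) (graph_norm A1) Q1,
        bounded_linear_on (dom A1) (graph_norm A1) Q0 &
        forall x, dom A1 x -> x = i1 (Q1 x) + A0 (i0 (Q0 x))]
}.

(* Main.v *)
Require Import Defs.
From HB Require Import structures.
From mathcomp Require Import all_boot all_order all_algebra complex.
From mathcomp Require Import all_classical all_reals all_analysis.

Import Order.TTheory GRing.Theory Num.Theory.
Import numFieldNormedType.Exports.

Local Open Scope classical_set_scope.
Local Open Scope ring_scope.

(** Write [B] for the adjoint of [A0], and let [S] be the set of the [x] in
    [D(A1)] and in [D(B)] whose norm is at most [M]. For [x] and [y] in [S], put
    [w = x - y] and decompose it as [w = u + A0 v], where [u = Q1 w] and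
    [v = Q0 w] are given by the potentials of the decomposition. Moving [A0] to
    the other side of the scalar product gives

      |w|^2 = <u, w> + <v, B w> <= |u| |w| + |v| |B w| <= 2 M (|u| + |v|),

    where the first inequality is [adjoint_norm_sqr_le] and the second one comes
    from [|w| <= 2 M] and [|B w| <= 2 M]. By linearity of the potentials, [u] and
    [v] are the components of [f x - f y], where [f x = (Q1 x, Q0 x)] is read in
    [H1 * H0]. So the estimate says that [f] has a uniformly continuous inverse
    on [S], for the norms of [H1] and [H0].

    On the other hand, [f] is bounded into the product of the two spaces of the
    decomposition, which embeds compactly into [H1 * H0]; hence [f @` S] is
    precompact in [H1 * H0] ([bounded_compact_comp], [precompactX]).
    Precompactness comes back from [f @` S] to [S] because [H1] is complete
    ([precompact_uniform_preimage]).

    Real and complex scalars need no separate treatment: the Cauchy-Schwarz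
    inequality [hdot_le] holds over every scalar field. *)

(** * Precompactness in complete uniform spaces *)

(** It is the closure of [A] that has to be compact, whereas the hypothesis only
    speaks of ultrafilters on [A] itself. A filter [G] on the closure is brought
    back to [A] by keeping its open members, which all meet [A]; regularity
    then makes the limit found in this way a cluster point of [G]. *)
Lemma precompact_ultra (T : topologicalType) (A : set T) : regular_space T ->
  (forall F : set_system T, UltraFilter F -> F A ->
     exists p : T, F --> p) ->
  precompact A.
Proof.
move=> regT cvgA; rewrite precompactE => G GF GA.
pose F := filter_from [set W | open W /\ G W] (fun W => A `&` W).
have FF : ProperFilter F.
  apply: filter_from_proper.
    apply: filter_from_filter.
      by exists setT; split; [exact: openT|exact: filterT].
    move=> V W [oV GV] [oW GW]; exists (V `&` W).
      by split; [exact: openI|exact: filterI].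
    by move=> x [Ax [Vx Wx]].
  move=> W [oW GW]; have [x [clAx Wx]] := filter_ex (filterI GA GW).
  by apply: clAx; apply: open_nbhs_nbhs.
have [U [UU sFU]] := ultraFilterLemma FF.
have UA : U A.
  by apply: sFU; exists setT => //=; split; [exact: openT|exact: filterT].
have [p Up] := cvgA U UU UA.
exists p; split.
  by move=> N /Up UN; exact: filter_ex (filterI UA UN).
move=> B N GB /regT [N' pN' N'N].
apply: contrapT => BN0.
(* If [B] missed [N], the complement of the closed neighborhood inside [N]
   would be an open member of [G], hence a member of [U], which converges to
   [p]. *)
have GW : G (~` closure N').
  by apply: filterS GB => y By /N'N Ny; apply: BN0; exists y.
have UW : U (~` closure N').
  apply: sFU; exists (~` closure N'); last by move=> y [].
  by split=> //; apply: closed_openC; exact: closed_closure.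
have [y [/subset_closure N'y nN'y]] := filter_ex (filterI (Up _ pN') UW).
exact: nN'y.
Qed.

(** The hypothesis is that [f] is injective on [S] with a uniformly continuous
    inverse. An ultrafilter on [S] is sent by [f] to an ultrafilter on a compact
    set, thus to a Cauchy one; so it is Cauchy itself and completeness
    applies. *)
Lemma precompact_uniform_preimage (X : uniformType) (V : completeType)
    (f : V -> X) (S : set V) :
  (forall E, entourage E ->
     exists2 D, entourage D &
       forall x y, S x -> S y -> D (f x, f y) -> E (x, y)) ->
  precompact (f @` S) -> precompact S.
Proof.
move=> finv [C fSC [cC _]]; apply: precompact_ultra => [|U UU US].
  exact: uniform_regular.
have UfC : U (f @^-1` C).
  by apply: filterS US => x Sx; apply: fSC; exists x.
have [p [_ clp]] := cC (f @ U) _ UfC.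
have fUp : f @ U --> p.
  move=> N pN; have [//|UnN] := in_ultra_setVsetC (f @^-1` N) UU.
  by have [y [nNy Ny]] := clp (~` N) N UnN pN.
exists (lim U); apply: cauchy_cvg => E /finv [D entD DE].
have entD' := entourage_invI (entourage_split_ent entD).
set N := f @^-1` xsection (split_ent D `&` (split_ent D)^-1%relation) p.
have USN : U (S `&` N).
  by apply: filterI => //; apply: fUp; exact: nbhs_entourage.
exists (S `&` N, S `&` N) => //= -[x y] /= [[Sx Nx] [Sy Ny]].
apply: DE => //; apply: (entourage_split p) => //.
  by move: Nx; rewrite /N /= => /xsectionP [].
by move: Ny; rewrite /N /= => /xsectionP [].
Qed.

Lemma precompactX (X Y : topologicalType) (A : set X) (B : set Y) :
  precompact A -> precompact B -> precompact (A `*` B).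
Proof.
move=> [A' AA' [cA clA]] [B' BB' [cB clB]]; exists (A' `*` B').
  by move=> [x y] [/AA' ? /BB' ?].
split; first exact: compact_setX.
apply: closedI; apply: preimage_closed => // -[x y] _; first exact: cvg_fst.
exact: cvg_snd.
Qed.

(** [Q] sends [S] into a ball of [W], whose image by [i] is precompact. [S] is
    not assumed to be a ball for [N], because it will be a ball for the norm
    that also controls the adjoint of [A0], which is stronger than [N]. *)
Lemma bounded_compact_comp (K : numFieldType) (U V W : normedModType K)
    (D S : set U) (N : U -> K) (Q : U -> W) (i : W -> V) (M : K) :
  bounded_linear_on D N Q -> compact_on setT (fun w => `|w|) i ->
  S `<=` D -> (forall x, S x -> 0 <= N x <= M) ->
  precompact ((i \o Q) @` S).
Proof.
move=> [_ [C QC]] ci SD NM; apply: (precompact_subset _ (ci (`|C| * M))).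
move=> _ [x Sx <-]; exists (Q x) => //; split=> //.
have /andP[N0 NleM] := NM _ Sx.
have QxC := QC _ (SD _ Sx).
rewrite (le_trans QxC)// -[leLHS]ger0_norm ?(le_trans _ QxC)// normrM.
by rewrite (ger0_norm N0) ler_wpM2l.
Qed.

(** * The estimate in Hilbert spaces *)

(** Cauchy-Schwarz, by Pythagoras for the decomposition of [n *: u] along [v]
    and its orthogonal. Multiplying [u] by [n = <v, v>] avoids a division, and
    the proof never needs to relate [theta] to the norm of scalars. *)
Lemma hdot_le (K : numFieldType) (theta : {rmorphism K -> K})
    (H : hilbertType theta) (u v : H) :
  `|hdot H u v| <= `|u| * `|v|.
Proof.
have [->|v0] := eqVneq v 0; first by rewrite linear0r !normr0 mulr0.
set d := hdot H u v; set n := hdot H v v.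
have nE : n = `|v| ^+ 2 by rewrite /n -hdot_norm.
have n0 : 0 < n by rewrite /n -hdot_norm exprn_gt0// normr_gt0.
pose w := n *: u - d *: v.
have ow : hdot H w (d *: v) = 0.
  have -> : hdot H w (d *: v) = theta d * hdot H w v by exact: linearZr_LR.
  have -> : hdot H w v = n * d - d * n.
    by rewrite /w linearBl/= !linearZl_LR.
  by rewrite mulrC (mulrC d) subrr mul0r.
have : hdot H (w + d *: v) (w + d *: v) =
       hdot H w w + hdot H (d *: v) (d *: v).
  exact: hnormDd.
rewrite subrK -!hdot_norm !normrZ !exprMn (gtr0_norm n0) => E.
have : `|d| ^+ 2 * `|v| ^+ 2 <= (`|u| * `|v|)^+ 2 * `|v| ^+ 2.
  have -> : (`|u| * `|v|) ^+ 2 * `|v| ^+ 2 = n ^+ 2 * `|u| ^+ 2.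
    by rewrite exprMn -nE -mulrA -expr2 mulrC.
  by rewrite E lerDr exprn_ge0.
rewrite ler_pM2r; last by rewrite exprn_gt0// normr_gt0.
by rewrite ler_pXn2r// nnegrE// mulr_ge0.
Qed.

(** This is where the adjoint enters: pairing [w] with [A0 v] amounts to
    pairing its image with [v], so that no norm of [A0 v] appears, only that of
    the potential [v]. *)
Lemma adjoint_norm_sqr_le (K : numFieldType) (theta : {rmorphism K -> K})
  (H0 H1 : hilbertType theta) (A0 : unbounded_op H0 H1)
  (dA0 : densely_defined A0) (u w : H1) (v : H0) :
  dom A0 v -> dom (adjoint dA0) w -> w = u + A0 v ->
  `|w| ^+ 2 <= `|u| * `|w| + `|v| * `|adjoint dA0 w|.
Proof.
move=> Dv /adjoint_funP Dw wE.
rewrite -[leLHS]ger0_norm ?exprn_ge0// hdot_norm {1}wE.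
have -> : hdot H1 (u + A0 v) w = hdot H1 u w + hdot H1 (A0 v) w.
  exact: linearDl.
rewrite (Dw _ Dv) (le_trans (ler_normD _ _))// lerD//; exact: hdot_le.
Qed.

(** * Compactness of the embedding *)

Lemma regular_decomposition_compact (K : numFieldType)
  (theta : {rmorphism K -> K})
  (H0 H1 H2 : hilbertType theta)
  (A0 : unbounded_op H0 H1) (A1 : unbounded_op H1 H2)
  (dA0 : densely_defined A0)
  (H0p H1p : hilbertType theta)
  (i0 : {linear H0p -> H0}) (i1 : {linear H1p -> H1}) :
  regular_decomposition A0 A1 i0 i1 ->
  compact_on (dom A1 `&` dom (adjoint dA0))
    (fun x : H1 => `|x| + `|A1 x| + `|adjoint dA0 x|)
    (fun x : H1 => x).
Proof.
case=> _ _ sub0 _ _ ci0 ci1 [Q1 [Q0 [bQ1 bQ0 QE]]] M.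
rewrite image_id; set S := [set x | _].
have NM x : S x -> 0 <= graph_norm A1 x <= M.
  move=> [_]; rewrite /graph_norm addr_ge0//=; apply: le_trans.
  by rewrite lerDl.
have SD : S `<=` dom A1 by move=> x [[]].
pose f x := (i1 (Q1 x), i0 (Q0 x)).
apply: (@precompact_uniform_preimage (H1 * H0)%type H1 f) => [E|]; last first.
  have p1 : precompact ((i1 \o Q1) @` S).
    exact: bounded_compact_comp bQ1 ci1 SD NM.
  have p0 : precompact ((i0 \o Q0) @` S).
    exact: bounded_compact_comp bQ0 ci0 SD NM.
  apply: precompact_subset (precompactX _ _ _ _ p1 p0).
  by move=> _ [x Sx <-]; split; exists x.
rewrite -entourage_ballE => -[e /= e0 eE].
(* With both components of [f x - f y] below [d], the estimate gives
   [|x - y|^2 <= d * (2 * M) + d * (2 * M)], which has to be less than [e ^+ 2];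
   the norm of [M] serves because [M] is known to be nonnegative only once [S]
   has an element. *)
pose c := 4 * `|M| + 1.
have c0 : 0 < c by rewrite ltr_wpDl// mulr_ge0.
pose d := e ^+ 2 / c.
have d0 : 0 < d by rewrite divr_gt0// exprn_gt0.
exists [set xy | ball xy.1 d xy.2]; first by rewrite -entourage_ballE; exists d.
move=> x y Sx Sy /= [].
rewrite -!ball_normE /ball_/= => d1 d2; apply: eE.
rewrite -ball_normE /ball_/=.
have [[DAx DBx] Nx] := Sx; have [[DAy DBy] Ny] := Sy.
pose w := (-1) *: y + x.
have wE : x - y = w by rewrite /w scaleN1r addrC.
have DAw : dom A1 w by exact: domP.
have DBw : dom (adjoint dA0) w by exact: domP.
have Bw : adjoint dA0 w = adjoint dA0 x - adjoint dA0 y.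
  have -> : adjoint dA0 w = (-1) *: adjoint dA0 y + adjoint dA0 x.
    exact: Defs.appP.
  by rewrite scaleN1r addrC.
have M0 : 0 <= M by have /andP[g0 gM] := NM _ Sx; exact: le_trans gM.
have w2M : `|w| <= 2 * M.
  rewrite -wE (le_trans (ler_normB _ _))// mulr_natl mulr2n lerD//.
    by rewrite (le_trans _ Nx)// -addrA lerDl addr_ge0.
  by rewrite (le_trans _ Ny)// -addrA lerDl addr_ge0.
have Bw2M : `|adjoint dA0 w| <= 2 * M.
  rewrite Bw (le_trans (ler_normB _ _))// mulr_natl mulr2n lerD//.
    by rewrite (le_trans _ Nx)// lerDr addr_ge0.
  by rewrite (le_trans _ Ny)// lerDr addr_ge0.
have Q1w : i1 (Q1 w) = i1 (Q1 x) - i1 (Q1 y).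
  by rewrite bQ1.1// linearP scaleN1r addrC.
have Q0w : i0 (Q0 w) = i0 (Q0 x) - i0 (Q0 y).
  by rewrite bQ0.1// linearP scaleN1r addrC.
have DQ0w : dom A0 (i0 (Q0 w)) by apply: sub0; exists (Q0 w).
rewrite -(ltr_pXn2r (n := 2)) ?nnegrE ?(ltW e0)// wE.
have := adjoint_norm_sqr_le _ _ _ _ _ dA0 _ _ _ DQ0w DBw (QE _ DAw).
rewrite Q1w Q0w => /le_lt_trans; apply.
have -> : e ^+ 2 = d * c by rewrite divfK// gt_eqF.
rewrite (@le_lt_trans _ _ (d * (2 * M) + d * (2 * M)))//.
  by rewrite lerD// ler_pM// ltW.
by rewrite -mulrDr ltr_pM2l// /c ger0_norm// -mulrDl -natrD ltrDl.
Qed.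

Theorem theorem2p11 (R : realType) (k : scalar_kind)
  (H0 H1 H2 : hilbertType (scalar_conj R k))
  (A0 : unbounded_op H0 H1) (A1 : unbounded_op H1 H2)
  (dA0 : densely_defined A0) (dA1 : densely_defined A1)
  (cA0 : closed_op A0) (cA1 : closed_op A1)
  (A01 : range_of A0 `<=` kernel_of A1)
  (H0p H1p : hilbertType (scalar_conj R k))
  (i0 : {linear H0p -> H0}) (i1 : {linear H1p -> H1})
  (reg : regular_decomposition A0 A1 i0 i1) :
  compact_on (dom A1 `&` dom (adjoint dA0))
    (fun x : H1 => `|x| + `|A1 x| + `|adjoint dA0 x|)
    (fun x : H1 => x).
Proof. exact: regular_decomposition_compact reg. Qed.
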